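(* Let $G$ be a simple graph of order $n$ with average degree $d$, let $0=\sigma_0\le\sigma_1\le\cdots\le\sigma_{n-1}$ be its Laplacian eigenvalues, and let $\theta>0$ be a real number such that $|d-\sigma_i|\le\theta$ for all $i=1,\dots,n-1$. Then $$\gamma(G)\ge\frac{d^2-\theta^2}{n\theta^2}.$$
   Context: The Laplacian matrix of $G$ is $L(G)=D(G)-A(G)$ (degree diagonal matrix minus adjacency matrix); its eigenvalues are the Laplacian eigenvalues, ordered increasingly. The average degree is $d=\frac1n\sum_v d_v$. For a proper subset $X$ of $V=V(G)$, let $N(X)=\{y\in V\setminus X:\ \{x,y\}\in E(G)\text{ for some }x\in X\}$ and let $X^+=V\setminus(X\cup N(X))$. The vertex expanding factor is $$\gamma(G)=\min\left\{\frac{|N(X)|}{|X|\,|X^+|}:\ X\subseteq V,\ 1\le|X|\le n-1,\ |X^+|\ge1\right\},$$ where the minimum over an empty set is $+\infty$. *)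

(* Defs.v *)
From HB Require Import structures.
From mathcomp Require Import all_boot all_order all_algebra.
From mathcomp Require Import constructive_ereal reals.

Set Implicit Arguments.
Unset Strict Implicit.
Unset Printing Implicit Defensive.

Import Order.TTheory GRing.Theory Num.Theory.

Local Open Scope ring_scope.

(* Throughout, a simple graph is a symmetric irreflexive relation e on a      *)
(* finType T; symmetry and irreflexivity are hypotheses of the theorems.      *)

Definition degree (T : finType) (e : rel T) (v : T) : nat :=
  #|[set w | e v w]|.

Definition avg_degree (R : realType) (T : finType) (e : rel T) : R :=
  #|T|%:R^-1 * \sum_(v : T) (degree e v)%:R.

(* Matrices are indexed by 'I_#|T|, the i-th vertex being enum_val i.         *)
Definition degree_mx (R : realType) (T : finType) (e : rel T) : 'M[R]_#|T| :=
  diag_mx (\row_i (degree e (enum_val i))%:R).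

Definition adjacency_mx (R : realType) (T : finType) (e : rel T) :
    'M[R]_#|T| :=
  \matrix_(i, j) (e (enum_val i) (enum_val j))%:R.

Definition laplacian (R : realType) (T : finType) (e : rel T) : 'M[R]_#|T| :=
  degree_mx R e - adjacency_mx R e.

(* Eigenvalues are listed with multiplicity, as the roots of the              *)
(* characteristic polynomial; this determines sigma, whose 0-th entry is the  *)
(* smallest eigenvalue.                                                       *)
Definition laplacian_eigenvalues (R : realType) (T : finType) (e : rel T)
    (sigma : #|T|.-tuple R) : Prop :=
  sorted <=%R sigma /\
  char_poly (laplacian R e) = \prod_(x <- sigma) ('X - x%:P).

Definition nbh (T : finType) (e : rel T) (X : {set T}) : {set T} :=
  [set y in ~: X | [exists x in X, e x y]].

(* The set X^+ of vertices neither in X nor adjacent to X. *)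
Definition far (T : finType) (e : rel T) (X : {set T}) : {set T} :=
  ~: (X :|: nbh e X).

Definition vertex_expansion (R : realType) (T : finType) (e : rel T) : \bar R :=
  \big[Order.min/+oo%E]_(X : {set T} |
      (1 <= #|X| <= #|T| - 1)%N && (1 <= #|far e X|)%N)
    (#|nbh e X|%:R / (#|X|%:R * #|far e X|%:R))%:E.

(* Main.v *)
Require Import Defs.
From HB Require Import structures.
From mathcomp Require Import all_boot all_order all_algebra.
From mathcomp Require Import constructive_ereal reals.
From mathcomp Require Import complex.
From mathcomp Require Import ring lra.

Set Implicit Arguments.
Unset Strict Implicit.
Unset Printing Implicit Defensive.

Import Order.TTheory GRing.Theory Num.Theory.

Local Open Scope ring_scope.

(* Expander mixing argument. Let Y be the set of vertices neither in X nor
   adjacent to X, and let x, y be the projections of the indicators of X, Y on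
   the orthogonal complement of the all-one vector 1. As there is no edge
   between X and Y, <x (L - d), y> = d |X||Y| / n. If d > theta, then 0 is a
   simple eigenvalue of L, so L - d has norm at most theta on the complement of
   1, and Cauchy-Schwarz gives
     d^2 |X||Y| <= theta^2 (n - |X|)(n - |Y|)
                 = theta^2 (n |N(X)| + |X||Y|).
   If d <= theta, the bound is trivial.                                       *)

(** * Spectral bound on the orthogonal complement of a simple eigenvector *)

Lemma char_poly_similar (F : fieldType) n (P A B : 'M[F]_n) :
  P \in unitmx -> P *m A = B *m P -> char_poly A = char_poly B.
Proof.
move=> Pu PA; pose Q := map_mx polyC P.
have Qu : \det Q != 0 by rewrite det_map_mx polyC_eq0 -unitfE -unitmxE.
have QE : Q *m char_poly_mx A = char_poly_mx B *m Q.
  rewrite /char_poly_mx mulmxBr mulmxBl -!map_mxM PA.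
  by rewrite mul_mx_scalar mul_scalar_mx.
by apply: (mulfI Qu); rewrite /char_poly -det_mulmx QE det_mulmx mulrC.
Qed.

(** The rows of [P] form an orthonormal eigenbasis of [A]. As [mu] is simple, [w] lies on a single
    basis vector, so [x] has no component there, and [A - c%:M] scales each other coordinate of [x]
    by at most [theta] in modulus. *)
Lemma unitary_diag_bound (C : numClosedFieldType) n (A P : 'M[C]_n)
    (sp : 'rV[C]_n) (s : seq C) (mu c theta : C) (w x : 'rV[C]_n) :
  P \is unitarymx -> P *m A = diag_mx sp *m P ->
  char_poly A = \prod_(a <- mu :: s) ('X - a%:P) -> mu \notin s ->
  (forall a, a \in s -> `|a - c| <= theta) ->
  w != 0 -> w *m A = mu *: w -> dotmx x w = 0 ->
  dotmx (x *m (A - c%:M)) (x *m (A - c%:M)) <= theta ^+ 2 * dotmx x x.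
Proof.
move=> Pun PA chA muNs sP w0 wA xw.
have Pu := unitarymx_unit Pun.
have iPE := invmx_unitary Pun.
have chA' : char_poly A = \prod_(i < n) ('X - (sp 0 i)%:P).
  rewrite (char_poly_similar Pu PA) char_poly_trig ?diag_mx_is_trig //.
  by apply: eq_bigr => i _; rewrite mxE eqxx.
(* [u *m invmx P] lists the coordinates of [u] in the basis of rows of [P]. *)
have dotP (u v : 'rV[C]_n) :
    dotmx u v = \sum_i (u *m invmx P) 0 i * ((v *m invmx P) 0 i)^*.
  rewrite -{1}[u](mulmxKV Pu) -{1}[v](mulmxKV Pu) dotmxE.
  rewrite trmx_mul map_mxM -iPE mulmxA mulmxK // !mxE.
  by apply: eq_bigr => i _; rewrite !mxE.
have AP : A *m invmx P = invmx P *m diag_mx sp.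
  by apply: (canRL (mulKmx Pu)); rewrite mulmxA PA mulmxK.
have [i0 spi0] : exists i0, sp 0 i0 = mu.
  have : root (char_poly A) mu by rewrite chA root_prod_XsubC mem_head.
  rewrite chA' /root horner_prod prodf_seq_eq0 => /hasP[i _ /=].
  by rewrite hornerXsubC subr_eq0 => /eqP ->; exists i.
(* Cancelling ['X - mu%:P] in the two factorizations of the characteristic polynomial leaves the
   other [sp 0 i] as roots of the product over [s]. *)
have spi i : i != i0 -> sp 0 i \in s.
  move=> ii0; rewrite -root_prod_XsubC.
  have := chA'; rewrite chA big_cons (bigD1 i0) //= spi0.
  move/mulfI => ->; last by rewrite polyXsubC_eq0.
  by rewrite /root horner_prod (bigD1 i) //= hornerXsubC subrr mul0r.
have wi i : i != i0 -> (w *m invmx P) 0 i = 0.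
  move=> ii0; have := congr1 (fun v => (v *m invmx P) 0 i) wA.
  rewrite /= -mulmxA AP mulmxA -scalemxAl mul_mx_diag !mxE => /eqP.
  rewrite mulrC -subr_eq0 -mulrBl mulf_eq0 => /orP[|/eqP //].
  by rewrite subr_eq0 => /eqP e; case/negP: muNs; rewrite -e spi.
(* Only the term at [i0] survives in the product of [x] and [w], and that coordinate of [w] is
   nonzero since [w] is. *)
have xi0 : (x *m invmx P) 0 i0 = 0.
  move: xw; rewrite dotP (bigD1 i0) //= big1 ?addr0 => [/eqP|i ii0]; last first.
    by rewrite wi // conjC0 mulr0.
  rewrite mulf_eq0 => /orP[/eqP //|]; rewrite conjC_eq0 => /eqP wi0.
  case/eqP: w0; rewrite -[w](mulmxKV Pu) (_ : w *m invmx P = 0) ?mul0mx //.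
  by apply/rowP=> i; rewrite [RHS]mxE; case: (eqVneq i i0) => [->|/wi].
rewrite !dotP mulr_sumr; apply: ler_sum => i _.
have -> : (x *m (A - c%:M) *m invmx P) 0 i =
    (x *m invmx P) 0 i * (sp 0 i - c).
  rewrite mulmxBr mulmxBl -mulmxA AP mulmxA mul_mx_scalar -scalemxAl.
  by rewrite mul_mx_diag !mxE mulrBr [c * _]mulrC.
rewrite -!normCK normrM exprMn mulrC.
case: (eqVneq i i0) => [->|/spi/sP le_theta].
  by rewrite xi0 normr0 expr0n !mulr0.
by rewrite ler_wpM2r ?exprn_ge0 // lerXn2r ?nnegrE // (le_trans _ le_theta).
Qed.

Lemma dotmx_map_real (R : rcfType) n (u v : 'rV[R]_n) :
  dotmx (map_mx (real_complex R) u) (map_mx (real_complex R) v) =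
  ((u *m v^T) 0 0)%:C%C.
Proof.
rewrite dotmxE !mxE rmorph_sum /=; apply: eq_bigr => i _.
by rewrite !mxE rmorphM /= (CrealP _) // complex_real.
Qed.

(** Over the complex extension a real symmetric matrix is normal, hence unitarily diagonalizable;
    the embedding of the reals preserves inner products and order, so the complex bound descends. *)
Lemma symmetric_orthogonal_bound (R : rcfType) n (A : 'M[R]_n) (s : seq R)
    (mu c theta : R) (w x : 'rV[R]_n) :
  A^T = A -> char_poly A = \prod_(a <- mu :: s) ('X - a%:P) -> mu \notin s ->
  (forall a, a \in s -> `|a - c| <= theta) ->
  w != 0 -> w *m A = mu *: w -> (x *m w^T) 0 0 = 0 ->
  ((x *m (A - c%:M)) *m (x *m (A - c%:M))^T) 0 0 <=
    theta ^+ 2 * (x *m x^T) 0 0.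
Proof.
move=> symA chA muNs sP w0 wA xw.
pose f := real_complex R; pose B := map_mx f A.
have Bnormal : B \is normalmx.
  apply: symmetric_normalmx.
    apply/is_hermitianmxP/matrixP=> i j; rewrite expr0 scale1r !mxE.
    by rewrite -[in LHS]symA mxE.
  by apply/mxOverP=> i j; rewrite mxE complex_real.
have /orthomx_spectralP BE := Bnormal.
have PB : spectralmx B *m B = diag_mx (spectral_diag B) *m spectralmx B.
  by rewrite {2}BE !mulmxA mulmxV ?spectral_unit // mul1mx.
have chB : char_poly B = \prod_(a <- f mu :: map f s) ('X - a%:P).
  rewrite -map_char_poly chA -(map_cons f) big_map rmorph_prod /=.
  by apply: eq_bigr => a _; rewrite map_polyXsubC.
have xAE : map_mx f (x *m (A - c%:M)) = map_mx f x *m (B - (f c)%:M).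
  by rewrite map_mxM map_mxB map_scalar_mx.
have xxE : (theta ^+ 2 * (x *m x^T) 0 0)%:C%C =
    f theta ^+ 2 * dotmx (map_mx f x) (map_mx f x).
  by rewrite rmorphM rmorphXn dotmx_map_real.
rewrite -lecR -dotmx_map_real xAE xxE.
apply: (unitary_diag_bound (w := map_mx f w) _ PB chB).
- exact: spectral_unitarymx.
- by rewrite (mem_map (@complexI R)).
- move=> _ /mapP[a a_s ->]; rewrite -rmorphB normc_def /= expr0n addr0.
  by rewrite sqrtr_sqr lecR sP.
- by rewrite map_mx_eq0.
- by rewrite -map_mxM wA map_mxZ.
- by rewrite dotmx_map_real xw.
Qed.

Lemma dot_CauchySchwarz (R : realFieldType) n (u v : 'rV[R]_n) :
  (u *m v^T) 0 0 ^+ 2 <= (u *m u^T) 0 0 * (v *m v^T) 0 0.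
Proof.
have dot_ge0 (w : 'rV[R]_n) : 0 <= (w *m w^T) 0 0.
  by rewrite mxE sumr_ge0 // => i _; rewrite !mxE -expr2 sqr_ge0.
set a := (v *m v^T) 0 0; set b := (u *m v^T) 0 0; set c := (u *m u^T) 0 0.
have [a0|a0] := eqVneq a 0.
  suff v0 : v = 0 by rewrite /b v0 trmx0 mulmx0 mxE expr0n mulr_ge0 // dot_ge0.
  apply/rowP=> i; move/eqP: a0; rewrite /a mxE psumr_eq0 => [|j _].
    by move/allP/(_ i (mem_index_enum _)); rewrite !mxE mulf_eq0 orbb => /eqP.
  by rewrite mxE -expr2 sqr_ge0.
have vu : v *m u^T = u *m v^T.
  by rewrite -[LHS]trmxK trmx_mul trmxK; apply/matrixP=> i j; rewrite mxE !ord1.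
(* This is the squared norm of [a *: u - b *: v], which is [a] times the component of [u] orthogonal
   to [v]. *)
have : 0 <= a * (a * c - b ^+ 2).
  rewrite (_ : _ * _ = ((a *: u - b *: v) *m (a *: u - b *: v)^T) 0 0) //.
  rewrite mulmxBl [(_ - _)^T]linearB /= ![(_ *: _)^T]linearZ /=.
  rewrite !mulmxBr -!scalemxAl -!scalemxAr !vu.
  move: (u *m u^T) (u *m v^T) (v *m v^T) @a @b @c a0 => M N Q a b c a0.
  by rewrite !mxE -/a -/b -/c; ring.
by rewrite pmulr_rge0 ?lt_def ?a0 ?dot_ge0 // subr_ge0 mulrC.
Qed.

(** * The Laplacian on indicator vectors, and the mixing inequality *)

Section LaplacianOfGraph.
Variables (R : realType) (T : finType) (e : rel T).
Hypothesis e_sym : symmetric e.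

Let L : 'M[R]_#|T| := laplacian R e.

Definition indicator (X : {set T}) : 'rV[R]_#|T| :=
  \row_i (enum_val i \in X)%:R.

Lemma laplacianE i j :
  L i j = (degree e (enum_val i))%:R *+ (i == j)
          - (e (enum_val i) (enum_val j))%:R.
Proof. by rewrite !mxE. Qed.

Lemma laplacian_sym : L^T = L.
Proof.
apply/matrixP=> i j; rewrite mxE !laplacianE e_sym eq_sym.
by case: eqP => [->|].
Qed.

Lemma sum_vertices (F : T -> R) : \sum_(i < #|T|) F (enum_val i) = \sum_x F x.
Proof. by rewrite -(big_enum_val F). Qed.

Lemma indicatorT_laplacian : indicator setT *m L = 0.
Proof.
apply/rowP=> j; rewrite !mxE.
under eq_bigr => i _ do rewrite laplacianE mxE inE mul1r e_sym.
rewrite sumrB (sum_vertices (fun x => (e (enum_val j) x)%:R)).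
rewrite (bigD1 j) //= eqxx mulr1n big1 => [|i /negPf -> //].
rewrite addr0 /degree -sum1_card natr_sum big_mkcond /=.
apply/eqP; rewrite subr_eq0; apply/eqP/eq_bigr => x _.
by rewrite inE; case: (e _ x).
Qed.

Lemma indicator_dot (X Y : {set T}) :
  (indicator X *m (indicator Y)^T) 0 0 = #|X :&: Y|%:R.
Proof.
rewrite -sum1_card natr_sum big_mkcond mxE.
rewrite -(sum_vertices (fun x => if x \in X :&: Y then 1 else 0)).
apply: eq_bigr => i _; rewrite !mxE inE.
by do 2!case: (_ \in _); rewrite /= ?mulr1 ?mulr0.
Qed.

(** Disjointness kills the diagonal entries of the Laplacian, and the absence of edges kills the
    others. *)
Lemma indicator_laplacian_dot (X Y : {set T}) :
    [disjoint X & Y] -> {in X & Y, forall x y, ~~ e x y} ->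
  (indicator X *m L *m (indicator Y)^T) 0 0 = 0.
Proof.
move=> XY0 noE; rewrite mxE big1 // => j _.
rewrite !mxE mulr_suml big1 // => i _.
rewrite laplacianE !mxE.
have [iX|] := boolP (enum_val i \in X); last by rewrite !mul0r.
have [jY|] := boolP (enum_val j \in Y); last by rewrite mulr0.
rewrite (negPf (noE _ _ iX jY)); case: eqP => [ij|_]; last first.
  by rewrite subrr mulr0 mul0r.
by have := disjointFr XY0 iX; rewrite ij jY.
Qed.

Lemma separated_sets_bound (s : seq R) (d theta : R) (X Y : {set T}) :
    char_poly L = \prod_(a <- 0 :: s) ('X - a%:P) -> 0 \notin s ->
    (forall a, a \in s -> `|a - d| <= theta) ->
    (0 < #|X|)%N -> (0 < #|Y|)%N ->
    [disjoint X & Y] -> {in X & Y, forall x y, ~~ e x y} ->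
  d ^+ 2 * (#|X|%:R * #|Y|%:R) <=
    theta ^+ 2 * ((#|T|%:R - #|X|%:R) * (#|T|%:R - #|Y|%:R)).
Proof.
move=> chL s0 sP X_gt0 Y_gt0 XY0 noE.
have n_gt0 : (0 < #|T|)%N by apply: leq_trans X_gt0 (max_card _).
pose one := indicator setT.
(* The projection of the indicator of [Z] on the complement of [one]. *)
pose center (Z : {set T}) := indicator Z - (#|Z|%:R / #|T|%:R) *: one.
have nR0 : #|T|%:R != 0 :> R by rewrite pnatr_eq0 -lt0n.
have centerM (Z W : {set T}) : (center Z *m (center W)^T) 0 0 =
    #|Z :&: W|%:R - #|Z|%:R * #|W|%:R / #|T|%:R.
  rewrite mulmxBl [(_ - _)^T]linearB /= ![(_ *: _)^T]linearZ /=.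
  rewrite !mulmxBr -!scalemxAl -!scalemxAr.
  have := (indicator_dot Z W, indicator_dot Z setT,
           indicator_dot setT W, indicator_dot setT setT).
  rewrite !setIT !setTI cardsT -/one => dots.
  move: (_ *m _) (_ *m _) (_ *m _) (_ *m _) dots => M1 M2 M3 M4 dots.
  by rewrite !mxE !dots; field.
have center1 Z : (center Z *m one^T) 0 0 = 0.
  rewrite mulmxBl -scalemxAl.
  have := (indicator_dot Z setT, indicator_dot setT setT).
  rewrite !setIT cardsT -/one => dots.
  move: (_ *m _) (_ *m _) dots => M1 M2 dots.
  by rewrite !mxE !dots; field.
have oneL : one *m L = 0 by exact: indicatorT_laplacian.
have Lone : L *m one^T = 0 by rewrite -laplacian_sym -trmx_mul oneL trmx0.
have one0 : one != 0.
  apply/eqP => /rowP/(_ (Ordinal n_gt0))/eqP.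
  by rewrite !mxE inE oner_eq0.
pose z := center X *m (L - d%:M).
have zz : (z *m z^T) 0 0 <= theta ^+ 2 * (center X *m (center X)^T) 0 0.
  apply: (symmetric_orthogonal_bound (w := one) laplacian_sym chL s0 sP one0).
    by rewrite oneL scale0r.
  exact: center1.
(* [L] annihilates [one] on both sides, so centering does not change its term, which is 0; the rest
   is [- d] times the product of the centered vectors, itself negative as [X] and [Y] are
   disjoint. *)
have zy : (z *m (center Y)^T) 0 0 = d * (#|X|%:R * #|Y|%:R / #|T|%:R).
  have zE : z *m (center Y)^T = indicator X *m L *m (indicator Y)^T
      - d *: (center X *m (center Y)^T).
    rewrite /z mulmxBr mul_mx_scalar mulmxBl -scalemxAl; congr (_ - _).
    rewrite mulmxBl -scalemxAl oneL scaler0 subr0.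
    rewrite [(_ - _)^T]linearB /= [(_ *: _)^T]linearZ /= mulmxBr -scalemxAr.
    rewrite -[_ *m L *m one^T]mulmxA Lone.
    by rewrite mulmx0 scaler0 subr0.
  move: (disjoint_setI0 XY0) => XYI.
  rewrite zE mxE [X in _ + X]mxE [X in _ - X]mxE indicator_laplacian_dot //.
  by rewrite centerM XYI cards0; ring.
have := dot_CauchySchwarz z (center Y).
rewrite zy => /le_trans/(_ (ler_wpM2r _ zz)).
rewrite !centerM !setIid.
set a := #|X|%:R; set b := #|Y|%:R; set n := #|T|%:R.
have a0 : 0 < a by rewrite ltr0n.
have b0 : 0 < b by rewrite ltr0n.
have n0 : 0 < n by rewrite ltr0n.
have b_le : b <= n by rewrite ler_nat max_card.
have -> : b - b * b / n = b / n * (n - b) by field; rewrite gt_eqF.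
have -> : a - a * a / n = a / n * (n - a) by field; rewrite gt_eqF.
(* The factor common to both sides of the Cauchy-Schwarz estimate. *)
have abn : 0 < a * b / n ^+ 2 by rewrite divr_gt0 ?mulr_gt0 ?exprn_gt0.
rewrite !mulr_ge0 ?invr_ge0 ?subr_ge0 ?(ltW b0) ?(ltW n0) // => /(_ isT) H.
rewrite -(ler_pM2l abn); move: H; congr (_ <= _); field; by rewrite gt_eqF.
Qed.

End LaplacianOfGraph.

(** * From the eigenvalue hypothesis to vertex expansion *)

Theorem theorem4p1 (R : realType) (T : finType) (e : rel T)
    (e_sym : symmetric e) (e_irr : irreflexive e)
    (n : nat) (n_gt0 : (0 < n)%N) (card_T : #|T| = n)
    (d : R) (d_avg : d = avg_degree R e)
    (sigma : #|T|.-tuple R) (sigmaP : laplacian_eigenvalues e sigma)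
    (theta : R) (theta_gt0 : 0 < theta)
    (theta_bound : forall i : 'I_#|T|, (1 <= i)%N ->
       `|d - tnth sigma i| <= theta) :
  (((d ^+ 2 - theta ^+ 2) / (n%:R * theta ^+ 2))%:E
     <= vertex_expansion R e)%E.
Proof.
apply/bigmin_geP; split=> [|X /andP[/andP[X_gt0 X_lt] Y_gt0]]; first exact: leey.
rewrite lee_fin; set Y := far e X in Y_gt0 *.
have nR0 : 0 < n%:R :> R by rewrite ltr0n.
have d_ge0 : 0 <= d by rewrite d_avg mulr_ge0 ?invr_ge0 ?sumr_ge0.
have rhs_ge0 : 0 <= #|nbh e X|%:R / (#|X|%:R * #|Y|%:R) :> R.
  by rewrite divr_ge0 ?mulr_ge0.
case: sigmaP => _ chL; set s := behead sigma.
(* [sigma] is nonempty because [n] is positive, so this head is its 0-th entry and not the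
   default. *)
have sE : sigma = head 0 sigma :: s :> seq R.
  rewrite /s; case: (sigma : seq R) (size_tuple sigma) => //= n0.
  by move: n_gt0; rewrite -card_T -n0.
have sP a : a \in s -> `|a - d| <= theta.
  case/(nthP 0) => i i_lt <-; rewrite size_behead size_tuple in i_lt.
  have i1_lt : (i.+1 < #|T|)%N by rewrite -ltn_predRL.
  rewrite distrC nth_behead.
  by have := theta_bound (Ordinal i1_lt) isT; rewrite (tnth_nth 0).
(* If 0 is a repeated eigenvalue, the hypothesis at 0 reads [d <= theta] and the claimed lower bound
   is nonpositive. *)
have [/sP|s0] := boolP (0 \in s).
  rewrite sub0r normrN ger0_norm // => d_le.
  apply: le_trans rhs_ge0; rewrite pmulr_lle0 ?invr_gt0 ?mulr_gt0 ?exprn_gt0 //.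
  by rewrite subr_le0 lerXn2r ?nnegrE // ltW.
(* The all-one vector makes 0 an eigenvalue; as 0 is not in [s], it must be the head of [sigma]. *)
have chL0 : char_poly (laplacian R e) = \prod_(a <- 0 :: s) ('X - a%:P).
  have : root (char_poly (laplacian R e)) 0.
    rewrite -eigenvalue_root_char; apply/eigenvalueP.
    exists (indicator R [set: T]).
      by rewrite indicatorT_laplacian // scale0r.
    apply/eqP => /rowP/(_ (cast_ord (esym card_T) (Ordinal n_gt0)))/eqP.
    by rewrite !mxE inE oner_eq0.
  by rewrite chL sE root_prod_XsubC inE (negPf s0) orbF => /eqP <-.
have XY0 : [disjoint X & Y].
  by rewrite -setI_eq0 /Y /far setCU setIA setICr set0I.
have noE : {in X & Y, forall x y, ~~ e x y}.
  move=> x y xX; rewrite !inE negb_or => /andP[yX].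
  by rewrite yX /= negb_exists_in => /forall_inP/(_ x xX).
have := separated_sets_bound e_sym chL0 s0 sP X_gt0 Y_gt0 XY0 noE.
have card_n : #|T|%:R = #|X|%:R + #|nbh e X|%:R + #|Y|%:R :> R.
  rewrite -!natrD -(cardsC (X :|: nbh e X)) cardsU.
  suff -> : X :&: nbh e X = set0 by rewrite cards0 subn0.
  by apply/setP=> x; rewrite !inE; case: (x \in X).
rewrite -card_T card_n.
have : 0 < #|X|%:R :> R by rewrite ltr0n.
have : 0 < #|Y|%:R :> R by rewrite ltr0n.
have : 0 <= #|nbh e X|%:R :> R by [].
move: (#|X|%:R) (#|Y|%:R) (#|nbh e X|%:R) => a b c c0 b0 a0 H.
have t2 : 0 < theta ^+ 2 by rewrite exprn_gt0.
rewrite ler_pdivrMr; last by rewrite mulr_gt0 // addr_gt0 // ltr_wpDr.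
rewrite mulrAC ler_pdivlMr ?mulr_gt0 //.
(* With [n] written as [a + c + b], the product of [n - a] and [n - b] is [n * c + a * b], which
   turns [H] into the goal. *)
nra.
Qed.
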